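(* For all integers $n,k\ge0$, $\sum_{\lambda\in\mathcal{E}_n^k}x^{w_{\mathcal{E}}^{\mathrm{lr}}(\lambda)}=\widehat{\mathscr{B}}_n^k(x)$ (where for $n=0$ or $k=0$ the left side is taken to be $1$).
   Context: $\widehat{\mathscr{B}}_n^k(x)=\sum_{j=0}^{\min(n,k)} j!\,(x+1)(x+2)\cdots(x+j)\,S(n+1,j+1)\,S(k+1,j+1)$, $S$ the Stirling numbers of the second kind. $[m]=\{1,\dots,m\}$. $\mathcal{E}_n^k$ is the set of permutations $\lambda$ of $[n+k+1]$ whose excedance set $\{i:\lambda(i)>i\}$ equals $[n]$. $w_{\mathcal{E}}^{\mathrm{lr}}(\lambda)$ is the number of $i\in\{n+1,\dots,n+k+1\}$ such that $\lambda(i)<\lambda(j)$ for all $j$ with $n<j<i$, minus one. *)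

(* Defs.v *)
From HB Require Import structures.
From mathcomp Require Import all_boot all_order all_algebra all_fingroup.

Set Implicit Arguments.
Unset Strict Implicit.
Unset Printing Implicit Defensive.

Import GRing.Theory.
Local Open Scope ring_scope.

Definition stirling2 (n k : nat) : nat :=
  #|[set P : {set {set 'I_n}} | partition P [set: 'I_n] & #|P| == k]|.

Definition poly_bernoulli_hat (n k : nat) : {poly int} :=
  \sum_(0 <= j < (minn n k).+1)
    (j`!)%:R * (\prod_(1 <= i < j.+1) ('X + i%:R))
    * (stirling2 n.+1 j.+1)%:R * (stirling2 k.+1 j.+1)%:R.

(* The set [m] is encoded as 'I_m, the ordinal i standing for the integer
   i + 1: thus [n] is the set of ordinals i < n, and {n+1, ..., n+k+1} is the
   set of ordinals i with n <= i. *)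

Definition excedance_set (m : nat) (s : 'S_m) : {set 'I_m} :=
  [set i : 'I_m | (i < s i)%N].

Definition exc_perms (n k : nat) : {set 'S_(n + k + 1)} :=
  [set s : 'S_(n + k + 1) |
    excedance_set s == [set i : 'I_(n + k + 1) | (i < n)%N]].

(* The first position n always counts as a left-to-right minimum, so the
   natural-number predecessor below never truncates. *)
Definition lr_weight (n k : nat) (s : 'S_(n + k + 1)) : nat :=
  #|[set i : 'I_(n + k + 1) | (n <= i)%N &
      [forall j : 'I_(n + k + 1), (n <= j < i)%N ==> (s i < s j)%N]]|.-1.

(* The value 1 when n = 0 or k = 0 is the stated convention; in these cases
   exc_perms n k is a singleton whose element has weight 0. *)
Definition exc_weight_sum (n k : nat) : {poly int} :=
  if (n == 0)%N || (k == 0)%N then 1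
  else \sum_(s in exc_perms n k) 'X^(lr_weight s).

(* Main.v *)
Require Import Defs.
From mathcomp Require Import all_boot all_order all_algebra all_fingroup.
From mathcomp Require Import zify ring.

(** Insert the values of [s] into their positions in decreasing order. A value
    is then a left-to-right minimum of the last [k + 1] positions exactly when it
    is put into the first of these positions that is still free, so the weight
    of [s] is a product of local factors. Call the [k] values above [n + 1] high
    and the others low. The high values that go to the last positions form a
    rook placement on a staircase board of size [k], counted by [S(k+1, j+1)]
    if [j] high values are left; the low values that go to the first [n]
    positions form a rook placement on a staircase of size [n], counted by
    [S(n+1, j+1)]; the [j] remaining high values and [j] remaining first
    positions are matched in [j!] ways; and the [j + 1] remaining low values,
    inserted in the last positions, contribute [x (x+1) ... (x+j)]. *)

Set Implicit Arguments.
Unset Strict Implicit.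
Unset Printing Implicit Defensive.

Import GRing.Theory.

(** * Sums over the subsets of a finite set *)

Lemma sum_subsetU1 (T : finType) (V : nmodType) (y : T) (D : {set T})
    (g : {set T} -> V) : y \notin D ->
  (\sum_(C : {set T} | C \subset y |: D) g C =
   \sum_(C : {set T} | C \subset D) g C +
   \sum_(C : {set T} | C \subset D) g (y |: C))%R.
Proof.
move=> yD; rewrite (bigID (fun C : {set T} => y \in C)) /= addrC; congr (_ + _)%R.
  apply: eq_bigl => C; apply/andP/idP => [[sC yC]|sC].
    by rewrite -(setU1K yD) subsetD1 sC.
  rewrite (contra (subsetP sC y) yD); split=> //.
  exact: subset_trans sC (subsetUr _ _).
rewrite (reindex_onto (fun C => y |: C) (fun C => C :\ y)) => [|C /andP[_ yC]] /=.
  apply: eq_bigl => C; rewrite setU11 andbT; apply/andP/idP => [[sC /eqP eC]|sC].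
    rewrite -eC -(setU1K yD); exact: setSD.
  by rewrite setUS // setU1K // (contra (subsetP sC y) yD).
by rewrite setD1K.
Qed.

(** Double counting of the pairs [(A, p)]: a set [B] arises as [A :\ p] once for each of the
    [#|U| - #|B|] elements [p] of [U] outside [B]. *)
Lemma sum_sub_setD1 (T : finType) (R : comNzSemiRingType) (U : {set T})
    (w : nat -> R) (g : {set T} -> R) :
  (\sum_(A : {set T} | A \subset U) w #|A| * \sum_(p in A) g (A :\ p) =
   \sum_(A : {set T} | A \subset U) w #|A|.+1 * (#|U| - #|A|)%:R * g A)%R.
Proof.
under eq_bigr do rewrite big_distrr /=.
rewrite (exchange_big_dep xpredT) //=.
transitivity (\sum_p \sum_(A : {set T} | (A \subset U) && (p \in U :\: A))
    w #|A|.+1 * g A)%R.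
  apply: eq_bigr => p _.
  rewrite (reindex_onto (fun A => p |: A) (fun A => A :\ p)) => [|A /andP[_ ?]].
    apply: eq_big => [A|A /andP[/andP[sA _] /eqP eA]].
      rewrite setU11 andbT subUset sub1set inE; apply/andP/andP.
        by case=> /andP[-> ->] /eqP <-; rewrite !inE eqxx.
      by case=> -> /andP[pA ->]; rewrite setU1K.
    rewrite eA cardsU1; suff -> : p \notin A by [].
    by rewrite -eA !inE eqxx.
  by rewrite setD1K.
rewrite (exchange_big_dep (fun A : {set T} => A \subset U)) /=; last first.
  by move=> p A _ /andP[].
apply: eq_bigr => A sA; rewrite sA /= sumr_const cardsD (setIidPr sA).
by rewrite mulr_natr mulrnAl.
Qed.

(** * Stirling numbers by recurrence and as counts of set partitions *)

Fixpoint stir (n k : nat) : nat :=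
  match n, k with
  | 0, 0 => 1
  | n'.+1, k'.+1 => k * stir n' k + stir n' k'
  | _, _ => 0
  end.

Lemma stir_small n k : n < k -> stir n k = 0.
Proof.
elim: n k => [|n IH] [|k] //=; rewrite ltnS => nk.
by rewrite !IH // ?muln0 // ltnW.
Qed.

Lemma stir1 n : stir n.+1 1 = 1.
Proof. by elim: n => //= n ->; case: n. Qed.

(** This is S(m+1, k+1) = sum_i binom(m, i) S(i, k), with the binomials written as sums over subsets
    so that it matches the recurrence of [card_partsU1]. *)
Lemma sum_subset_stir (T : finType) (D : {set T}) k :
  \sum_(C : {set T} | C \subset D) stir #|C| k = stir #|D|.+1 k.+1.
Proof.
move: {2}#|D| (erefl #|D|) => m; elim: m D k => [|m IHm] D k cD.
  move/eqP: (cD); rewrite cards_eq0 cD => /eqP ->.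
  rewrite (big_pred1 set0) => [|C]; last by rewrite subset0.
  by rewrite cards0 /= muln0.
have /set0Pn[y yD'] : D != set0 by rewrite -cards_eq0 cD.
rewrite -(setD1K yD'); set D' := D :\ y.
have yD : y \notin D' by rewrite !inE eqxx.
have IH j : \sum_(C : {set T} | C \subset D') stir #|C| j = stir #|D'|.+1 j.+1.
  by apply: IHm; have := cardsD1 y D; rewrite yD' cD => -[].
move: D' yD IH => {yD' cD IHm}D yD IH.
have -> : \sum_(C : {set T} | C \subset y |: D) stir #|C| k =
    \sum_(C : {set T} | C \subset D) stir #|C| k +
    \sum_(C : {set T} | C \subset D) stir #|y |: C| k by exact: sum_subsetU1.
rewrite cardsU1 yD add1n IH.
have cU (C : {set T}) : C \subset D -> #|y |: C| = #|C|.+1.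
  by move=> sC; rewrite cardsU1 (contra (subsetP sC y) yD).
rewrite (eq_bigr (fun C : {set T} => stir #|C|.+1 k)); last by move=> C /cU ->.
case: k => [|k]; first by rewrite big1 // addn0 !stir1.
rewrite (eq_bigr (fun C : {set T} => k.+1 * stir #|C| k.+1 + stir #|C| k)) //.
rewrite big_split /= -big_distrr /= !IH /=; lia.
Qed.

Definition parts (T : finType) (D : {set T}) (k : nat) : {set {set {set T}}} :=
  [set P : {set {set T}} | partition P D & #|P| == k].

(* [C] is the complement in [D] of the block containing [x]. *)
Lemma card_partsU1 (T : finType) (x : T) (D : {set T}) k : x \notin D ->
  #|parts (x |: D) k.+1| = \sum_(C : {set T} | C \subset D) #|parts C k|.
Proof.
move=> xD; rewrite -sum1_card.
rewrite (partition_big (fun P => D :\: pblock P x) (fun C => C \subset D)) /=;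
  last by move=> P _; exact: subsetDl.
apply: eq_bigr => C sC; rewrite sum1_card.
pose B := (x |: D) :\: C.
have xC : x \notin C by apply: contra xD; apply: (subsetP sC).
have xB : x \in B by rewrite !inE eqxx xC.
have B0 : B != set0 by apply/set0Pn; exists x.
have dBC : [disjoint B & C]
  by rewrite disjoints_subset; apply/subsetP => z; rewrite !inE => /andP[].
have sC' : C \subset x |: D by apply: subset_trans sC (subsetUr _ _).
have UB : B :|: C = x |: D.
  apply/setP => z; rewrite !inE; have := subsetP sC' z; rewrite !inE.
  by case: (z \in C) => /= [->|_]; rewrite ?orbT ?orbF.
have BQ Q : partition Q C -> B \notin Q.
  move=> pQ; apply/negP => /(partitionS pQ) /subsetP/(_ x xB).
  by rewrite (negPf xC).
(* Adding the block [B] maps the partitions of [C] bijectively to the partitions in which [B] is the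
   block of [x]. *)
rewrite -(card_in_imset (f := fun Q => B |: Q) (D := parts C k)); last first.
  move=> Q Q'; rewrite !inE => /andP[pQ _] /andP[pQ' _] eQ.
  by rewrite -(setU1K (BQ _ pQ)) eQ setU1K // BQ.
apply: eq_card => P; rewrite [LHS]unfold_in /= inE.
apply/andP/imsetP; last first.
  case=> Q; rewrite inE => /andP[pQ /eqP cQ] ->.
  have pP := partitionU1 pQ B0 dBC; rewrite -UB pP cardsU1 BQ // cQ eqxx; split=> //.
  rewrite (def_pblock (partition_trivIset pP) (setU11 _ _) xB).
  apply/eqP/setP=> z; rewrite !inE.
  case zC: (z \in C); first by rewrite (subsetP sC).
  by rewrite andbC; case: (z \in D) => //; rewrite orbT.
case=> /andP[pP /eqP cP] /eqP eC.
have xP : x \in cover P by rewrite (cover_partition pP) setU11.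
have BP := pblock_mem xP.
have eB : pblock P x = B.
  apply/setP => z; rewrite /B -eC !inE.
  have := subsetP (partitionS pP BP) z; rewrite !inE.
  have [-> |_ /=] := eqVneq z x; first by rewrite mem_pblock xP (negPf xD).
  by case: (z \in pblock P x) => // [->//|_]; case: (z \in D).
rewrite eB in BP.
exists (P :\ B); last by rewrite setD1K.
rewrite inE; have := cardsD1 B P; rewrite BP cP add1n => -[->]; rewrite eqxx andbT.
by have := partitionD1 pP BP; rewrite setDDr setDv set0U (setIidPr sC').
Qed.

Lemma card_parts (T : finType) (D : {set T}) k : #|parts D k| = stir #|D| k.
Proof.
have [m] := ubnP #|D|; elim: m D k => // m IH D k; rewrite ltnS => Dm.
have [->|[x xD]] := set_0Vmem D.
  rewrite /parts cards0; case: k => [|k].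
    rewrite (_ : [set _ | _] = [set set0]) ?cards1 //.
    apply/setP => P; rewrite !inE partition_set0.
    by case: eqP => // ->; rewrite cards0.
  rewrite (_ : [set _ | _] = set0) ?cards0 //.
  apply/setP => P; rewrite !inE partition_set0.
  by case: eqP => // ->; rewrite cards0.
rewrite -(setD1K xD) cardsU1 !inE eqxx add1n.
case: k => [|k].
  apply/eqP; rewrite cards_eq0; apply/eqP/setP=> P; rewrite !inE.
  apply/negP => /andP[pP]; rewrite cards_eq0 => /eqP P0.
  have := cover_partition pP; rewrite P0 /cover big_set0 => /setP/(_ x).
  by rewrite !inE eqxx.
rewrite card_partsU1 ?inE ?eqxx // -sum_subset_stir.
apply: eq_bigr => C sC; apply: IH; apply: leq_trans Dm.
by rewrite (cardsD1 x D) xD ltnS subset_leq_card.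
Qed.

Lemma stirling2E n k : stirling2 n k = stir n k.
Proof. by have := card_parts [set: 'I_n] k; rewrite cardsT card_ord => <-. Qed.

(** * Weighted insertion of values in decreasing order *)

Local Open Scope ring_scope.

(* [F] is the set of free positions when the value [#|F|.-1] is inserted at [p]. *)
Definition step (n N : nat) (F : {set 'I_N}) (p : 'I_N) : {poly int} :=
  (if (p < n)%N then (p < #|F|.-1)%N else (#|F|.-1 <= p)%N)%:R *
  (if (n <= p)%N && [forall q in F, (n <= q)%N ==> (p <= q)%N]
   then 'X else 1).

(** The list gives the positions of the values in decreasing order, so its current entries are the
    free positions. In [step], the first factor enforces the excedance condition at [p] and the
    second marks left-to-right minima. *)
Fixpoint list_weight (n N : nat) (t : seq 'I_N) : {poly int} :=
  if t is p :: t' then step n [set x in t] p * list_weight n t' else 1.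

Definition filling_sum (n N : nat) (F : {set 'I_N}) : {poly int} :=
  \sum_(t <- permutations (enum F)) list_weight n t.

Lemma filling_sum0 n N : filling_sum n (set0 : {set 'I_N}) = 1.
Proof. by rewrite /filling_sum enum_set0 big_seq1. Qed.

Lemma filling_sumE n N (F : {set 'I_N}) : (0 < #|F|)%N ->
  filling_sum n F = \sum_(p in F) step n F p * filling_sum n (F :\ p).
Proof.
rewrite cardE => F0; rewrite /filling_sum (perm_big _ (permutationsE F0)) /=.
rewrite big_allpairs_dep undup_id ?enum_uniq // big_enum /=.
apply: eq_bigr => p pF; rewrite big_distrr /=.
have pe : perm_eq (rem p (enum F)) (enum (F :\ p)).
  apply: uniq_perm; rewrite ?rem_uniq ?enum_uniq // => q.
  by rewrite mem_rem_uniq ?enum_uniq // !inE !mem_enum !inE.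
rewrite (perm_big _ (perm_permutations pe)) /=.
rewrite !big_seq; apply: eq_bigr => t; rewrite mem_permutations => /perm_mem et.
congr (step _ _ _ * _); apply/setP => q; rewrite !inE et mem_enum !inE.
by case: eqP => [->|].
Qed.

(** * Low values: staircase placements and rising factorials *)

Definition rise (b : nat) : {poly int} := \prod_(i < b) ('X + i%:R).

Definition below (N m : nat) : {set 'I_N} := [set p : 'I_N | (p < m)%N].

Lemma card_below N m : (m <= N)%N -> #|below N m| = m.
Proof.
move=> mN; rewrite -[RHS]card_ord -!sum1_card (big_ord_widen N (fun=> 1%N) mN).
by apply: eq_bigl => p; rewrite inE.
Qed.

(* Placements of the positions in [A] into the values below [y], each position
   [p] receiving a value above [p], built from the largest value down. *)
Fixpoint low (N y : nat) (A : {set 'I_N}) : nat :=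
  if y is y'.+1 then
    (\sum_(p in A | (p < y')%N) low y' (A :\ p) + low y' A)%N
  else A == set0.

Lemma low_small N y (A : {set 'I_N}) : (y < #|A|)%N -> low y A = 0%N.
Proof.
elim: y A => [|y IH] A yA /=; first by rewrite -cards_eq0 eqn0Ngt yA.
rewrite big1 ?add0n; first by apply: IH; apply: ltnW.
by move=> p /andP[pA _]; apply: IH; move: yA; rewrite (cardsD1 p A) pA.
Qed.

(** The position [p] needs a value above [p] and below [y], and there is none. *)
Lemma low_eq0 N y (A : {set 'I_N}) (p : 'I_N) :
  p \in A -> (y <= p.+1)%N -> low y A = 0%N.
Proof.
elim: y A => [|y IH] A pA yp /=; first by case: eqP pA => // ->; rewrite inE.
rewrite big1 ?add0n; first by apply: IH => //; apply: ltnW.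
move=> q /andP[qA qy]; apply: IH; rewrite ?inE ?pA ?andbT; last exact: ltnW.
by apply/eqP => e; move: qy; rewrite -e; lia.
Qed.

(* Splitting on whether the largest value [m] is used gives the Stirling
   recurrence. The sets [A] containing the last position [m.-1] drop out once
   that value is gone, by [low_eq0]. *)
Lemma low_sum N m j : (m <= N)%N ->
  (\sum_(A : {set 'I_N} | A \subset below N m) (#|A| + j == m)%N * low m.+1 A)%N
  = stir m.+1 j.+1.
Proof.
elim: m j => [|m IH] j mN.
  rewrite (big_pred1 set0) => [|C]; last first.
    by rewrite (_ : below N 0 = set0) ?subset0 //; apply/setP => p; rewrite !inE.
  have -> : low 1 (set0 : {set 'I_N}) = 1%N.
    by rewrite /= big_pred0 ?eqxx // => p; rewrite inE.
  by rewrite cards0 muln1 /=; case: j => // j; rewrite muln0.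
have -> : (\sum_(A : {set 'I_N} | A \subset below N m.+1)
    (#|A| + j == m.+1)%N * low m.+2 A =
  \sum_(A : {set 'I_N} | A \subset below N m.+1)
    (#|A| + j == m.+1)%N * \sum_(p in A) low m.+1 (A :\ p) +
  \sum_(A : {set 'I_N} | A \subset below N m.+1)
    (#|A| + j == m.+1)%N * low m.+1 A)%N.
  rewrite -big_split /=; apply: eq_bigr => A sA.
  rewrite -mulnDr; congr (_ * (_ + _))%N; apply: eq_bigl => p.
  by case pA: (p \in A) => //=; have := subsetP sA p pA; rewrite inE.
have pm : (m < N)%N by [].
have sBm : below N m.+1 = Ordinal pm |: below N m.
  by apply/setP => p; rewrite !inE ltnS leq_eqVlt.
have nBm : Ordinal pm \notin below N m by rewrite inE ltnn.
have restrict (w : {set 'I_N} -> nat) :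
    (\sum_(A : {set 'I_N} | A \subset below N m.+1) w A * low m.+1 A =
     \sum_(A : {set 'I_N} | A \subset below N m) w A * low m.+1 A)%N.
  have := sum_subsetU1 (fun A => w A * low m.+1 A)%N nBm.
  rewrite -sBm => ->; rewrite [X in _ + X]big1 ?addr0 // => A _.
  by rewrite (low_eq0 (setU11 _ _)) ?muln0.
rewrite restrict.
have -> : (\sum_(A : {set 'I_N} | A \subset below N m.+1)
    (#|A| + j == m.+1)%N * \sum_(p in A) low m.+1 (A :\ p) =
  \sum_(A : {set 'I_N} | A \subset below N m.+1)
    (#|A|.+1 + j == m.+1)%N * (m.+1 - #|A|) * low m.+1 A)%N.
  have := sum_sub_setD1 (below N m.+1) (fun a => (a + j == m.+1)%N : nat)
    (@low N m.+1).
  rewrite card_below // => ->.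
  by apply: eq_bigr => A _; rewrite natn.
rewrite restrict.
(* On the support [#|A| + j = m], so the factor [m.+1 - #|A|] is the constant [j.+1]. *)
have -> : (\sum_(A : {set 'I_N} | A \subset below N m)
    (#|A|.+1 + j == m.+1)%N * (m.+1 - #|A|) * low m.+1 A =
    j.+1 * \sum_(A : {set 'I_N} | A \subset below N m)
    (#|A| + j == m)%N * low m.+1 A)%N.
  rewrite big_distrr /=; apply: eq_bigr => A _.
  by rewrite addSn eqSS; case: eqP => [<-|]; rewrite ?muln0 ?mul0n //; nia.
rewrite IH; last exact: ltnW.
rewrite -[stir m.+2 j.+1]/(j.+1 * stir m.+1 j.+1 + stir m.+1 j)%N.
(* For [j = 0] the condition asks for [m.+1] elements in a subset of [below N m], so the sum
   vanishes, as does S(m+1, 0). *)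
congr (_ + _)%N; case: j => [|j].
  rewrite big1 // => A sA; have := subset_leq_card sA.
  by rewrite card_below ?(ltnW mN) //; case: eqP => //; lia.
by rewrite -IH ?(ltnW mN) //; apply: eq_bigr => A _; rewrite addnS eqSS.
Qed.

(** Only the least element of [G] carries ['X]; every other one carries 1. *)
Lemma sum_min N (n : nat) (F : {set 'I_N}) :
  let G := F :\: below N n in (0 < #|G|)%N ->
  \sum_(p in G) (if (n <= p)%N && [forall q in F, (n <= q)%N ==> (p <= q)%N]
     then 'X else 1) = 'X + #|G|.-1%:R :> {poly int}.
Proof.
move=> G; rewrite card_gt0 => /set0Pn[p0 p0G].
case: (@arg_minnP _ p0 (mem G) (fun p : 'I_N => p : nat) p0G) => p pG' pmin'.
have pG : p \in G := pG'.
have pmin q : q \in G -> (p <= q)%N := pmin' q.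
have GE q : (q \in G) = (n <= q)%N && (q \in F) by rewrite !inE -leqNgt.
rewrite (bigD1 p) //=; congr (_ + _).
  have [-> _] /= := andP (etrans (esym (GE p)) pG); case: forall_inP => // [[]] q qF.
  by apply/implyP => nq; apply: pmin; rewrite GE nq.
rewrite (eq_bigr (fun=> 1)) => [|q /andP[qG qp]]; last first.
  case: ifP => // /andP[_ /forall_inP qmin].
  move: pG; rewrite GE => /andP[np pF]; have := qmin p pF; rewrite np /= => qlep.
  by case/eqP: qp; apply: val_inj; apply/eqP; rewrite eqn_leq qlep pmin.
rewrite (eq_bigl (fun q => q \in G :\ p)) => [|q]; last by rewrite !inE andbC.
by rewrite sumr_const (cardsD1 p G) pG.
Qed.

(** The value inserted is at most [n], so every free last position admits it. Using a first position
    gives the sum in the recurrence of [low]; using a last one gives its other term and, by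
    [sum_min], the top factor of [rise]. *)
Lemma filling_sum_low n N (F : {set 'I_N}) : (#|F| <= n.+1)%N ->
  filling_sum n F =
  (low #|F| (F :&: below N n))%:R * rise (#|F| - #|F :&: below N n|).
Proof.
move cF: #|F| => y; elim: y F cF => [|y IH] F cF yn.
  move/eqP: cF; rewrite cards_eq0 => /eqP ->.
  rewrite filling_sum0 set0I /= eqxx mul1r.
  by rewrite /rise big_ord0.
rewrite filling_sumE ?cF //.
set A := F :&: below N n; set G := F :\: below N n.
have cAG : (#|A| + #|G|)%N = y.+1 by rewrite cardsID.
have cD p : p \in F -> #|F :\ p| = y.
  by move=> pF; have := cardsD1 p F; rewrite pF cF add1n => -[].
rewrite (bigID (fun p => p \in below N n)) /= natrD mulrDl; congr (_ + _).
  rewrite natr_sum big_distrl /=.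
  rewrite (eq_bigl (fun p => p \in A)) => [|p]; last by rewrite !inE.
  rewrite [RHS]big_mkcondr; apply: eq_bigr => p; rewrite !inE => /andP[pF pn].
  rewrite /step cF pn (leqNgt n p) pn /= mulr1.
  case: ifP => py; last by rewrite mul0r.
  rewrite mul1r IH ?cD ?(ltnW yn) //.
  have -> : (F :\ p) :&: below N n = A :\ p by rewrite setIDAC.
  congr (_ * rise _); have := cardsD1 p A; rewrite !inE pF pn add1n => ->.
  by rewrite subSS.
rewrite (eq_bigl (fun p => p \in G)) => [|p]; last by rewrite !inE andbC.
rewrite (eq_bigr (fun p : 'I_N =>
    (if (n <= p)%N && [forall q in F, (n <= q)%N ==> (p <= q)%N]
     then 'X else 1) * ((low y A)%:R * rise (y - #|A|)))) => [|p]; last first.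
  rewrite !inE -leqNgt => /andP[np pF].
  rewrite /step cF np ltnNge np /= (leq_trans _ np) // mul1r.
  rewrite IH ?cD ?(ltnW yn) //; have -> // : (F :\ p) :&: below N n = A.
  by apply/setP => q; rewrite !inE; case: eqP => // ->; rewrite ltnNge np !andbF.
rewrite -big_distrl /=.
(* Without a free last position, [A] has [y.+1] elements, too many for [y] values, and both sides
   vanish. *)
have [G0|G0] := posnP #|G|.
  by rewrite low_small ?mul0r ?mulr0 //; lia.
rewrite sum_min // mulrCA; congr (_ * _).
have -> : (y.+1 - #|A| = #|G|)%N by lia.
have -> : (y - #|A| = #|G|.-1)%N by lia.
by case: #|G| G0 => // g _; rewrite /rise big_ord_recr /= mulrC.
Qed.

(** * High values: iterated transfer *)

(* One high value is inserted while the positions in [A] are free among the first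
   [n]: it goes to one of them, or to one of the [n - #|A| + 1] admissible free
   positions among the last ones. *)
Definition transfer (N n : nat) (g : {set 'I_N} -> {poly int}) (A : {set 'I_N})
    : {poly int} :=
  \sum_(p in A) g (A :\ p) + (n - #|A|).+1%:R * g A.

(** Induction on [k]: with j = n - |A|, the coefficient of [g A] satisfies j (j-1)! S(k+1, j) +
    (j+1) j! S(k+1, j+1) = j! S(k+2, j+1). *)
Lemma iter_transfer N n k (g : {set 'I_N} -> {poly int}) (U : {set 'I_N}) :
  #|U| = n ->
  iter k (transfer n) g U =
  \sum_(A : {set 'I_N} | A \subset U)
    ((n - #|A|)`! * stir k.+1 (n - #|A|).+1)%:R * g A.
Proof.
move=> cU; elim: k g => [|k IH] g.
  rewrite (bigD1 U) //= cU subnn /= mul1r big1 ?addr0 // => A /andP[sA nA].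
  have : (#|A| < #|U|)%N by rewrite proper_card // properEneq nA.
  rewrite cU -subn_gt0; case: (n - #|A|)%N => // m _.
  by rewrite /= !muln0 mul0r.
rewrite iterSr {}IH /transfer.
have rec j : stir k.+2 j.+1 = (j.+1 * stir k.+1 j.+1 + stir k.+1 j)%N by [].
have : stir k.+1 0 = 0%N by [].
move: (stir k.+1) (stir k.+2) rec => f f' rec f0.
under eq_bigr do rewrite mulrDr.
rewrite big_split /= (sum_sub_setD1 U
  (fun a => ((n - a)`! * f (n - a).+1)%:R : {poly int}) g).
rewrite -big_split /=; apply: eq_bigr => A sA.
rewrite mulrA -mulrDl cU -!natrM -natrD; congr (_%:R * _).
have := subset_leq_card sA; rewrite cU => cA.
have [e|[m em]] : (n - #|A| = 0)%N \/
    exists m, (n - #|A|.+1 = m)%N /\ (n - #|A| = m.+1)%N.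
- by case e: (n - #|A|)%N => [|m]; [left | right; exists m; lia].
- by rewrite e rec f0 muln0; lia.
by case: em => -> ->; rewrite factS rec; nia.
Qed.

(** While high values are inserted, the positions from [n] to [n + d] stay free. Since [n] is free,
    a high value in a last position is never a left-to-right minimum, so no ['X] appears before the
    low values. *)
Lemma filling_sum_high n N d (F : {set 'I_N}) :
  #|F| = (n.+1 + d)%N -> (forall p : 'I_N, (n <= p <= n + d)%N -> p \in F) ->
  (n + d < N)%N ->
  filling_sum n F =
  iter d (transfer n) (fun A : {set 'I_N} => (low n.+1 A)%:R * rise (n.+1 - #|A|))
    (F :&: below N n).
Proof.
elim: d F => [|d IH] F cF hF dN; first by rewrite filling_sum_low cF addn0.
rewrite filling_sumE ?cF // [iter _ _ _ _]/= {1}/transfer.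
have cF1 : #|F|.-1 = (n + d.+1)%N by rewrite cF.
set A := F :&: below N n; set H := F :\: below N (n + d.+1).
have cD p : p \in F -> #|F :\ p| = (n.+1 + d)%N.
  by move=> pF; have := cardsD1 p F; rewrite pF cF add1n addnS => -[].
rewrite (bigID (fun p => p \in below N n)) /=; congr (_ + _).
  rewrite (eq_bigl (fun p => p \in A)) => [|p]; last by rewrite !inE.
  apply: eq_bigr => p; rewrite !inE => /andP[pF pn].
  rewrite /step cF1 pn (leqNgt n p) pn /= mulr1 ltn_addr // mul1r.
  rewrite IH ?cD //; last by lia.
    by rewrite setIDAC.
  move=> q /andP[nq qd]; rewrite !inE hF ?andbT ?nq ?addnS 1?ltnW //.
  by apply/eqP => e; move: nq; rewrite e leqNgt pn.
have nN : (n < N)%N by lia.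
have nF : Ordinal nN \in F by apply: hF => /=; lia.
(* A last position below the inserted value would become an excedance; only those in [H] remain. *)
rewrite (bigID (fun p => p \in H)) /= [X in _ + X]big1 ?addr0 => [|p]; last first.
  rewrite !inE -!leqNgt => /andP[/andP[pF np]]; rewrite pF andbT -ltnNge => pd.
  by rewrite /step cF1 ltnNge np /= leqNgt pd !mul0r.
rewrite (eq_bigl (fun p => p \in H)) => [|p]; last first.
  by rewrite !inE -!leqNgt; case: (p \in F) => //=; rewrite ?andbF ?andbT //=; lia.
rewrite (eq_bigr (fun=> iter d (transfer n)
    (fun A : {set 'I_N} => (low n.+1 A)%:R * rise (n.+1 - #|A|)) A)) => [|p]; last first.
  rewrite !inE -leqNgt => /andP[pd pF]; have np : (n <= p)%N by lia.
  rewrite /step cF1 ltnNge np /= pd mul1r.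
  have -> : [forall q in F, (n <= q)%N ==> (p <= q)%N] = false.
    apply/negbTE/forall_inPn; exists (Ordinal nN) => //=.
    by rewrite leqnn -ltnNge; lia.
  rewrite mul1r IH ?cD //; last by lia.
    congr (iter _ _ _ _).
    by apply/setP => q; rewrite !inE; case: eqP => // ->; rewrite ltnNge np !andbF.
  move=> q /andP[nq qd]; rewrite !inE hF ?andbT ?nq ?addnS 1?ltnW //.
  by apply/eqP => e; move: pd; rewrite -e; lia.
(* [H] has [#|F| - #|A| - d.+1] elements, because the [d.+1] positions from [n] to [n + d] are all
   free. *)
rewrite sumr_const mulr_natl; congr (_ *+ _).
have := cardsID (below N (n + d.+1)) F; rewrite cF -/H.
have := cardsID (below N n) (F :&: below N (n + d.+1)).
have -> : F :&: below N (n + d.+1) :&: below N n = A.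
  by apply/setP => q; rewrite !inE -andbA; congr (_ && _); lia.
have -> : F :&: below N (n + d.+1) :\: below N n =
    below N (n + d.+1) :\: below N n.
  apply/setP => q; rewrite !inE -leqNgt andbA andbAC.
  by apply: andb_idr => /andP[nq qd]; apply: hF; lia.
have := cardsID (below N n) (below N (n + d.+1)).
have -> : below N (n + d.+1) :&: below N n = below N n.
  by apply/setP => q; rewrite !inE; lia.
have := subset_leq_card (subsetIr F (below N n)); rewrite -/A.
rewrite !card_below ?(ltnW nN) ?(ltnW dN) //.
by move: #|A| #|_ :\: below N n| #|_ :&: below N _| #|H| => *; lia.
Qed.

(** * Permutations and their insertion orders *)

Lemma list_weight_prod n N (t : seq 'I_N) : uniq t ->
  list_weight n t = \prod_(p <- t) step n [set x in drop (index p t) t] p.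
Proof.
elim: t => [|p t IH] /=; first by rewrite big_nil.
case/andP=> pt ut; rewrite big_cons eqxx drop0 IH // big_seq [in RHS]big_seq.
congr (_ * _); apply: eq_bigr => q qt.
by case: eqP => // e; rewrite e qt in pt.
Qed.

(* The positions of the values of [s], from the largest value to the smallest. *)
Definition insertion_order N (s : 'S_N) : seq 'I_N :=
  [seq (s^-1)%g (rev_ord i) | i <- enum 'I_N].

Lemma insertion_order_inj N : injective (@insertion_order N).
Proof.
move=> s s' /eq_in_map e; apply: invg_inj; apply/permP => i.
by have := e (rev_ord i); rewrite mem_enum rev_ordK; apply.
Qed.

Lemma insertion_order_uniq N (s : 'S_N) : uniq (insertion_order s).
Proof.
by rewrite map_inj_uniq ?enum_uniq // => i j /perm_inj/rev_ord_inj.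
Qed.

Lemma mem_insertion_order N (s : 'S_N) p : p \in insertion_order s.
Proof.
by apply/mapP; exists (rev_ord (s p)); rewrite ?mem_enum // rev_ordK permK.
Qed.

Lemma index_insertion_order N (s : 'S_N) p :
  index p (insertion_order s) = rev_ord (s p).
Proof.
rewrite -[in LHS](permK s p) -[s p in LHS]rev_ordK index_map; last first.
  by move=> i j /perm_inj/rev_ord_inj.
by rewrite index_enum_ord.
Qed.

(** [insertion_order] is injective into the orderings of all positions, and both sides have [N]!
    elements. *)
Lemma filling_sumT n N :
  filling_sum n [set: 'I_N] = \sum_(s : 'S_N) list_weight n (insertion_order s).
Proof.
rewrite -(big_map (@insertion_order N) xpredT (@list_weight n N)).
apply: perm_big; apply: uniq_perm.
- exact: permutations_uniq.
- by rewrite map_inj_uniq ?index_enum_uniq //; apply: insertion_order_inj.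
apply: fsym.
have sub t : t \in [seq insertion_order s | s <- index_enum 'S_N] ->
    t \in permutations (enum [set: 'I_N]).
  case/mapP => s _ ->; rewrite mem_permutations; apply: uniq_perm.
  - exact: insertion_order_uniq.
  - exact: enum_uniq.
  by move=> p; rewrite mem_insertion_order mem_enum inE.
apply: (uniq_min_size _ sub _).2.
  by rewrite map_inj_uniq ?index_enum_uniq //; apply: insertion_order_inj.
rewrite size_permutations ?enum_uniq // -cardE cardsT card_ord size_map.
by rewrite -card_Sn -sum1_size -[leqLHS]sum1_card.
Qed.

(** When the value [s p] is inserted, the free positions are those with values at most [s p]; hence
    [#|F|.-1] is [s p] and each local factor becomes a condition on [s]. *)
Lemma list_weight_insertion n N (s : 'S_N) :
  list_weight n (insertion_order s) =
  (excedance_set s == below N n)%:R *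
  'X^#|[set i : 'I_N | (n <= i)%N &
        [forall j : 'I_N, (n <= j < i)%N ==> (s i < s j)%N]]|.
Proof.
rewrite list_weight_prod ?insertion_order_uniq //.
have pe : perm_eq (insertion_order s) (index_enum 'I_N).
  apply: uniq_perm; rewrite ?insertion_order_uniq ?index_enum_uniq // => p.
  by rewrite mem_insertion_order mem_index_enum.
rewrite (perm_big _ pe) /=.
have FE p : [set x in drop (index p (insertion_order s)) (insertion_order s)] =
    [set x | (s x <= s p)%N].
  apply/setP => x; rewrite !inE.
  set t := insertion_order s; set i := index p t.
  have := insertion_order_uniq s; have := mem_insertion_order s x.
  rewrite -/t -{1 2}(cat_take_drop i t) mem_cat cat_uniq.
  move=> xt /and3P[_ /hasPn disj _].
  have -> : (x \in drop i t) = ~~ (x \in take i t).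
    move: xt (disj x); case: (x \in drop _ _) => /= [_ -> //|].
    by rewrite orbF => ->.
  rewrite in_take ?mem_insertion_order // /i !index_insertion_order -leqNgt /=.
  by have := ltn_ord (s x); have := ltn_ord (s p); lia.
have cF p : #|[set x | (s x <= s p)%N]| = (s p).+1.
  rewrite -[RHS](card_below (ltn_ord (s p))) -[RHS](card_imset _ (@perm_inj _ (s^-1)%g)).
  apply: eq_card => x; rewrite inE; apply/idP/imsetP => [xp|[y]].
    by exists (s x); rewrite ?inE ?permK.
  by rewrite inE => yp ->; rewrite permKV.
under eq_bigr => p _ do rewrite FE /step cF.
rewrite big_split /=; congr (_ * _).
  case: eqP => [/setP e|ne].
    rewrite big1 // => p _; have := e p; rewrite !inE => <-.
    by case: ltnP => // ->.
  have [p pne] : exists p, (p \in excedance_set s) != (p \in below N n).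
    apply/existsP; rewrite -negb_forall; apply/negP => /forallP e; apply: ne.
    by apply/setP => p; apply/eqP.
  rewrite (bigD1 p) //=; move: pne; rewrite !inE.
  by case: ltnP => [_|sp]; case: ltnP => // _; rewrite ?mul0r // leqNgt.
rewrite -big_mkcond /= prodr_const; congr ('X^_); apply: eq_card => i.
rewrite [LHS]unfold_in !inE /=; case: (n <= i)%N => //=.
apply/forall_inP/forallP => [h j|h j].
  apply/implyP => /andP[nj ji]; rewrite ltnNge; apply/negP => sji.
  by have := h j; rewrite inE sji nj leqNgt ji => /(_ isT).
rewrite inE => sji; apply/implyP => nj; rewrite leqNgt; apply/negP => ji.
by have := h j; rewrite nj ji /= ltnNge sji.
Qed.

(** The factor ['X] restores the minimum at position [n], which [lr_weight] subtracts. *)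
Lemma exc_sum_filling n k :
  (\sum_(s in exc_perms n k) 'X^(lr_weight s)) * 'X =
  filling_sum n [set: 'I_(n + k + 1)].
Proof.
rewrite filling_sumT big_distrl big_mkcond /=; apply: eq_bigr => s _.
rewrite list_weight_insertion inE -/(below _ n); case: eqP; rewrite ?mul0r // mul1r.
move=> _; rewrite -exprSr /lr_weight prednK // card_gt0; apply/set0Pn.
have nN : (n < n + k + 1)%N by lia.
exists (Ordinal nN); rewrite inE /= leqnn; apply/forallP => j.
by apply/implyP => /andP[nj jn]; move: nj; rewrite leqNgt jn.
Qed.

(** * Comparison with the poly-Bernoulli polynomial *)

Arguments stir : simpl never.

Lemma poly_bernoulli_hatE n k : poly_bernoulli_hat n k =
  \sum_(j < n.+1) (j`!)%:R * (\prod_(1 <= i < j.+1) ('X + i%:R))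
    * (stir n.+1 j.+1)%:R * (stir k.+1 j.+1)%:R.
Proof.
rewrite /poly_bernoulli_hat big_mkord.
under eq_bigr do rewrite !stirling2E.
rewrite (big_ord_widen n.+1 (fun j => (j`!)%:R * (\prod_(1 <= i < j.+1) ('X + i%:R))
    * (stir n.+1 j.+1)%:R * (stir k.+1 j.+1)%:R : {poly int})); last by lia.
rewrite big_mkcond; apply: eq_bigr => j _; case: ltnP => // jnk.
by rewrite (@stir_small k.+1) ?mulr0 //; have := ltn_ord j; lia.
Qed.

Lemma riseS j : rise j.+1 = (\prod_(1 <= i < j.+1) ('X + i%:R)) * 'X.
Proof.
rewrite /rise -(big_mkord xpredT (fun i => 'X + i%:R)).
by rewrite big_nat_recl // addr0 mulrC big_add1.
Qed.

Lemma filling_sum_bernoulli n k :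
  filling_sum n [set: 'I_(n + k + 1)] = poly_bernoulli_hat n k * 'X.
Proof.
rewrite (@filling_sum_high n _ k) ?cardsT ?card_ord; try lia;
  last by move=> p; rewrite inE.
rewrite setTI (iter_transfer _ _ (card_below _)); last lia.
rewrite poly_bernoulli_hatE big_distrl /=.
(* Group the sets [A] of first positions left free by the high values according to [j = n - #|A|];
   within a group only [low] varies, and [low_sum] adds it up. *)
rewrite (partition_big (fun A : {set 'I_(n + k + 1)} =>
  inord (n - #|A|) : 'I_n.+1) xpredT) //=.
apply: eq_bigr => j _.
transitivity ((stir n.+1 j.+1)%:R *
    ((j`!)%:R * (stir k.+1 j.+1)%:R * rise j.+1) : {poly int}); last first.
  by rewrite riseS; ring.
rewrite -(@low_sum (n + k + 1) n j); last lia.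
rewrite natr_sum big_distrl /= [LHS]big_mkcondr; apply: eq_bigr => A sA.
have := subset_leq_card sA; rewrite card_below; last lia.
move: #|A| => a an; have -> : (inord (n - a) == j) = (a + j == n)%N.
  by rewrite -val_eqE /= inordK; [apply/eqP/eqP; lia | lia].
case: eqP => [e|_]; last by rewrite mul0n mul0r.
rewrite mul1n (_ : n - a = j)%N; last lia.
rewrite (_ : n.+1 - a = j.+1)%N; last lia.
by rewrite natrM; ring.
Qed.

Theorem theorem4p4 (n k : nat) :
  exc_weight_sum n k = poly_bernoulli_hat n k.
Proof.
rewrite /exc_weight_sum; case: ifP => [nk0|_]; last first.
  have X0 : 'X != 0 :> {poly int} by rewrite polyX_eq0.
  apply: (mulIf X0).
  by rewrite exc_sum_filling filling_sum_bernoulli.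
(* In the conventional case only the term [j = 0] is left, and it equals 1. *)
rewrite /poly_bernoulli_hat (_ : minn n k = 0%N);
  last by case/orP: nk0 => /eqP ->; rewrite ?minn0 ?min0n.
by rewrite big_nat1 big_geq // !stirling2E !stir1 !mulr1.
Qed.
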